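(* Let $X$ be a metric space. (i) Fix $\sigma\geq 1$ and $\lambda>1$. If $X$ is $\sigma$-quasiconvex, then $BCl(X)$ is $\sigma\lambda$-quasiconvex. (ii) Fix $\lambda\geq 1$. If $X$ is $\lambda$-quasiconvex, then $FS(X)$ is $\lambda$-quasiconvex. (iii) Fix $\lambda\geq 1$. If $X$ is proper and $\lambda$-quasiconvex, then $BCl(X)=K(X)$ is $\lambda$-quasiconvex.
   Context: $BCl(X)$, $K(X)$ and $FS(X)$ denote respectively the sets of nonempty bounded closed, nonempty compact, and nonempty finite subsets of $X$, each a metric space with the Hausdorff distance $d_H(A,B)=\max\{\sup_{a\in A}\inf_{b\in B}d(a,b),\ \sup_{b\in B}\inf_{a\in A}d(a,b)\}$. For $\lambda\geq1$, a path (continuous map) $\gamma:[0,1]\to Y$ in a metric space $Y$ is a $\lambda$-quasigeodesic if $d(\gamma(t),\gamma(t'))\leq\lambda d(\gamma(0),\gamma(1))|t-t'|$ for all $t,t'\in[0,1]$. $Y$ is $\lambda$-quasiconvex if every two points of $Y$ are connected by a $\lambda$-quasigeodesic in $Y$. A metric space is proper if every bounded closed subset of it is compact. *)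

(* Defs.v *)
From HB Require Import structures.
From mathcomp Require Import all_boot all_order all_algebra.
From mathcomp Require Import all_classical all_reals all_analysis.
Import Order.TTheory GRing.Theory Num.Theory.
Import numFieldNormedType.Exports.

Set Implicit Arguments.
Unset Strict Implicit.
Unset Printing Implicit Defensive.

Local Open Scope classical_set_scope.
Local Open Scope ring_scope.

(* The library's [bounded_set] needs a norm; this is its metric counterpart. *)
Definition metric_bounded (R : realType) (X : metricType R) (A : set X) : Prop :=
  exists M : R, forall x y, A x -> A y -> mdist x y <= M.

Definition BCl_sets (R : realType) (X : metricType R) : set (set X) :=
  [set A | [/\ A !=set0, metric_bounded A & closed A]].

Definition K_sets (R : realType) (X : metricType R) : set (set X) :=
  [set A | A !=set0 /\ compact A].

Definition FS_sets (R : realType) (X : metricType R) : set (set X) :=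
  [set A | A !=set0 /\ finite_set A].

Arguments BCl_sets {R} X _.
Arguments K_sets {R} X _.
Arguments FS_sets {R} X _.

(* [sup] and [inf] are real-valued with junk value 0; for nonempty bounded sets
   all the sets below are nonempty and bounded. *)
Definition hausdorff_dist (R : realType) (X : metricType R) (A B : set X) : R :=
  Num.max (sup [set inf [set mdist a b | b in B] | a in A])
          (sup [set inf [set mdist a b | a in A] | b in B]).

Lemma BCl_sub_BCl (R : realType) (X : metricType R) :
  BCl_sets X `<=` BCl_sets X.
Proof. by []. Qed.

Lemma K_sub_BCl (R : realType) (X : metricType R) : K_sets X `<=` BCl_sets X.
Proof.
move=> A [[a Aa] cA]; split; [by exists a| |].
- have /compact_near_coveringP nc := cA.
  have : \forall M \near +oo, A `<=` [set x | mdist a x <= M].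
    apply: (nc R +oo (fun M x => mdist a x <= M)) => x Ax.
    exists (ball x 1, [set M | mdist a x + 1 < M]).
      split; first exact: nbhsx_ballx.
      by exists (mdist a x + 1); split => //; exact: num_real.
    move=> [y M] /= [+ ltM]; rewrite ballEmdist/= => xy.
    rewrite ltW// (le_lt_trans (metric_triangle a x y))//.
    by apply: lt_trans ltM; rewrite ltrD2l.
  move=> [M [_ /(_ (M + 1))]]; rewrite ltrDl ltr01 => /(_ isT) AM.
  exists ((M + 1) + (M + 1)) => x y Ax Ay.
  rewrite (le_trans (metric_triangle x a y))// lerD//; last exact: AM.
  by rewrite metric_sym; exact: AM.
- exact: (compact_closed (@metric_hausdorff R X)).
Qed.

Lemma FS_sub_BCl (R : realType) (X : metricType R) : FS_sets X `<=` BCl_sets X.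
Proof.
by move=> A [A0 fA]; apply: K_sub_BCl; split=> //; exact: finite_compact.
Qed.

Lemma excess_leP (R : realType) (X : metricType R) (A B : set X) (r : R) :
  BCl_sets X A -> BCl_sets X B ->
  sup [set inf [set mdist a b | b in B] | a in A] <= r <->
  forall e, 0 < e -> forall a, A a -> exists2 b, B b & mdist a b < r + e.
Proof.
move=> [[a0 Aa0] [M AM] _] [[b0 Bb0] _ _].
have lb a : has_lbound [set mdist a b | b in B].
  by exists 0 => _ [b _ <-]; exact: mdist_ge0.
split=> [supr e e0 a Aa|near].
- have [|_ [b Bb <-] ab] := @inf_adherent _ [set mdist a b | b in B] _ e0.
    by split; [exists (mdist a b0), b0|exact: lb].
  exists b => //; apply: (lt_le_trans ab); rewrite lerD2r.
  apply: le_trans supr; apply: ub_le_sup; last by exists a.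
  exists (M + mdist a0 b0) => _ [a' Aa' <-].
  apply: (@le_trans _ _ (mdist a' b0)); first by apply: ge_inf => //; exists b0.
  by rewrite (le_trans (metric_triangle a' a0 b0))// lerD2r AM.
- apply: ge_sup; first by exists (inf [set mdist a0 b | b in B]), a0.
  move=> _ [a Aa <-]; apply/ler_addgt0Pr => e e0.
  have [b Bb /ltW ab] := near e e0 a Aa.
  by apply: le_trans ab; apply: ge_inf => //; exists b.
Qed.

Lemma hausdorff_distE (R : realType) (X : metricType R) (A B : set X) :
  hausdorff_dist A B =
  Num.max (sup [set inf [set mdist a b | b in B] | a in A])
          (sup [set inf [set mdist b a | a in A] | b in B]).
Proof.
rewrite /hausdorff_dist; congr (Num.max _ (sup _)).
apply: eq_imagel => b _; congr inf.
by apply: eq_imagel => a _; exact: metric_sym.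
Qed.

Lemma hausdorff_dist_leP (R : realType) (X : metricType R) (A B : set X)
    (r : R) : BCl_sets X A -> BCl_sets X B ->
  hausdorff_dist A B <= r <->
  (forall e, 0 < e -> forall a, A a -> exists2 b, B b & mdist a b < r + e) /\
  (forall e, 0 < e -> forall b, B b -> exists2 a, A a & mdist b a < r + e).
Proof.
move=> hA hB; rewrite hausdorff_distE ge_max; split.
  by move=> /andP[/excess_leP-/(_ hA hB) ? /excess_leP-/(_ hB hA) ?].
by move=> [? ?]; apply/andP; split; apply/excess_leP.
Qed.

(* A family P of nonempty bounded closed subsets of X, as a type endowed with
   the Hausdorff metric; the inclusion PB is what makes it a metric. *)
Record hyperspace (R : realType) (X : metricType R) (P : set (set X))
    (PB : P `<=` BCl_sets X) := Hyperspace {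
  hyperspace_set :> set X ;
  hyperspace_setP : P hyperspace_set }.

HB.instance Definition _ (R : realType) (X : metricType R) (P : set (set X))
  (PB : P `<=` BCl_sets X) := gen_eqMixin (hyperspace PB).
HB.instance Definition _ (R : realType) (X : metricType R) (P : set (set X))
  (PB : P `<=` BCl_sets X) := gen_choiceMixin (hyperspace PB).

Definition hdist (R : realType) (X : metricType R) (P : set (set X))
  (PB : P `<=` BCl_sets X) (A B : hyperspace PB) : R := hausdorff_dist A B.

Lemma hyperspaceB (R : realType) (X : metricType R) (P : set (set X))
  (PB : P `<=` BCl_sets X) (A : hyperspace PB) : BCl_sets X A.
Proof. exact: PB (hyperspace_setP A). Qed.

Lemma hdistxx (R : realType) (X : metricType R) (P : set (set X))
  (PB : P `<=` BCl_sets X) (A : hyperspace PB) : hdist A A = 0.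
Proof.
have hA := hyperspaceB A; apply/eqP; rewrite eq_le; apply/andP; split.
  apply/(hausdorff_dist_leP _ hA hA).
  by split=> e e0 a Aa; exists a => //; rewrite mdistxx add0r.
apply/ler_addgt0Pr => e e0.
have [/(_ e e0) + _] := (hausdorff_dist_leP _ hA hA).1 (lexx (hdist A A)).
have [[a Aa] _ _] := hA => /(_ a Aa) [b _ ab].
by rewrite ltW// (le_lt_trans _ ab)// mdist_ge0.
Qed.

Lemma hdist_positivity (R : realType) (X : metricType R) (P : set (set X))
  (PB : P `<=` BCl_sets X) (A B : hyperspace PB) : hdist A B = 0 -> A = B.
Proof.
have sub (C D : set X) : closed D ->
    (forall e, 0 < e -> forall c, C c -> exists2 d, D d & mdist c d < 0 + e) ->
    C `<=` D.
  move=> cD CD c Cc; apply: cD => U /nbhs_ballP[e /= e0 eU].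
  have [d Dd cd] := CD e e0 c Cc; exists d; split=> //.
  by apply: eU; rewrite ballEmdist/= -[e]add0r.
move=> AB0; have hA := hyperspaceB A; have hB := hyperspaceB B.
have AB0le : hausdorff_dist A B <= 0 by rewrite [hausdorff_dist _ _]AB0.
have [AB BA] := (hausdorff_dist_leP _ hA hB).1 AB0le.
have eAB : hyperspace_set A = hyperspace_set B.
  have [_ _ cA] := hA; have [_ _ cB] := hB.
  by apply/seteqP; split; exact: sub.
case: A B eAB {AB0 AB0le hA hB AB BA} => [A PA] [B PB'] /= AB; subst B.
by congr Hyperspace; exact: Prop_irrelevance.
Qed.

Lemma hdist_sym (R : realType) (X : metricType R) (P : set (set X))
  (PB : P `<=` BCl_sets X) (A B : hyperspace PB) : hdist A B = hdist B A.
Proof. by rewrite /hdist !hausdorff_distE maxC. Qed.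

Lemma hdist_triangle (R : realType) (X : metricType R) (P : set (set X))
  (PB : P `<=` BCl_sets X) (B A C : hyperspace PB) :
  hdist A C <= hdist A B + hdist B C.
Proof.
have hA := hyperspaceB A; have hB := hyperspaceB B; have hC := hyperspaceB C.
have [AB BA] := (hausdorff_dist_leP _ hA hB).1 (lexx (hdist A B)).
have [BC CB] := (hausdorff_dist_leP _ hB hC).1 (lexx (hdist B C)).
apply/(hausdorff_dist_leP _ hA hC); split=> e e0 x xS;
  have e20 : 0 < e / 2 by rewrite divr_gt0.
- have [b Bb xb] := AB _ e20 x xS; have [c Cc bc] := BC _ e20 b Bb.
  exists c => //; rewrite (le_lt_trans (metric_triangle x b c))//.
  by rewrite (splitr e) addrACA ltrD.
- have [b Bb xb] := CB _ e20 x xS; have [a Aa ba] := BA _ e20 b Bb.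
  exists a => //; rewrite (le_lt_trans (metric_triangle x b a))//.
  by rewrite (splitr e) addrACA (addrC (mdist x b)) ltrD.
Qed.

HB.instance Definition _ (R : realType) (X : metricType R) (P : set (set X))
    (PB : P `<=` BCl_sets X) :=
  isMetric.Build R (hyperspace PB) (@hdistxx R X P PB)
    (@hdist_positivity R X P PB) (@hdist_sym R X P PB)
    (@hdist_triangle R X P PB).

Definition BCl (R : realType) (X : metricType R) : metricType R :=
  hyperspace (@BCl_sub_BCl R X).
Definition K (R : realType) (X : metricType R) : metricType R :=
  hyperspace (@K_sub_BCl R X).
Definition FS (R : realType) (X : metricType R) : metricType R :=
  hyperspace (@FS_sub_BCl R X).

(* A path is represented by a function on R, only its restriction to [0, 1]
   being relevant. *)
Definition quasigeodesic (R : realType) (Y : metricType R) (lambda : R)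
    (gamma : R -> Y) : Prop :=
  {within `[0, 1], continuous gamma} /\
  forall t t', t \in `[0, 1] -> t' \in `[0, 1] ->
    mdist (gamma t) (gamma t') <=
      lambda * mdist (gamma 0) (gamma 1) * `|t - t'|.

Definition quasiconvex (R : realType) (Y : metricType R) (lambda : R) : Prop :=
  forall x y : Y, exists gamma : R -> Y,
    [/\ quasigeodesic lambda gamma, gamma 0 = x & gamma 1 = y].
Arguments quasiconvex {R} Y lambda.

Definition proper_metric (R : realType) (X : metricType R) : Prop :=
  forall A : set X, metric_bounded A -> closed A -> compact A.

(* Main.v *)
Require Import Defs.
From HB Require Import structures.
From mathcomp Require Import all_boot all_order all_algebra.
From mathcomp Require Import all_classical all_reals all_analysis.
From mathcomp Require Import ring lra.
Import Order.TTheory GRing.Theory Num.Theory.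
Import numFieldNormedType.Exports.

Local Open Scope classical_set_scope.
Local Open Scope ring_scope.

(** Write h for the Hausdorff distance of A and B, and let D be the set of the
    pairs (a, b) in A x B with d(a, b) <= r. If every point of A is the first
    component of a pair in D, and every point of B the second component of one,
    then joining the pairs of D by sigma-quasigeodesics g_(a,b) produces a path
    of sets from A to B,
      t |-> closure {g_(a,b)(t) : (a, b) in D}.
    Each g_(a,b) is (sigma r)-Lipschitz, and so the path is (sigma r)-Lipschitz
    for the Hausdorff distance: following the same curve from time s to time t
    leads from a point of the first set to a nearby point of the second. This is
    [hyperspace_lipschitz_path].

    It remains to choose r. For bounded closed sets the infimum that defines the
    distance from a point of A to B need not be attained. If h > 0, then
    r = lambda h with lambda > 1 leaves the required room, at the cost of the
    factor lambda; if h = 0, then A = B and a constant path will do. For compact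
    sets nearest points exist ([compact_nearest]), and r = h suffices.

    The intermediate sets lie in the right hyperspace: they are always closed,
    bounded and nonempty; they are finite if A and B are; and they are compact
    if X is proper. *)

(** Paths here are Lipschitz on all of [R], not only on [0, 1]: this
    makes continuity a global statement, and [quasiconvexP] shows that nothing
    is lost. *)
Definition lipschitz_path {R : realType} {Y : metricType R} (C : R)
    (f : R -> Y) : Prop :=
  forall s t, mdist (f s) (f t) <= C * `|s - t|.

Lemma lipschitz_path_continuous {R : realType} {Y : metricType R} {C : R}
  {f : R -> Y} : lipschitz_path C f -> continuous f.
Proof.
move=> lipf x; apply/metricType_numDomainType.cvgrPdist_lt => e e0.
(* C may vanish (or be negative), so the modulus is taken from |C| + 1. *)
have C0 : 0 < `|C| + 1 by rewrite ltr_wpDl.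
near=> t; apply: (le_lt_trans (lipf x t)).
apply: (@le_lt_trans _ _ ((`|C| + 1) * `|x - t|)).
  by rewrite ler_wpM2r// (le_trans (ler_norm C))// lerDl.
rewrite mulrC -ltr_pdivlMr//; near: t.
have : 0 < e / (`|C| + 1) by rewrite divr_gt0.
exact: (@cvgr_dist_lt _ _ _ (nbhs x) _ id x).
Unshelve. all: by end_near. Qed.

Definition clamp01 {R : realType} (t : R) : R := Num.max 0 (Num.min 1 t).

Lemma clamp01_itv {R : realType} (t : R) : clamp01 t \in `[0, 1].
Proof.
by rewrite in_itv/= /clamp01 le_max lexx ge_max ler01 ge_min lexx.
Qed.

Lemma clamp01_nonexpansive {R : realType} (s t : R) :
  `|clamp01 s - clamp01 t| <= `|s - t|.
Proof.
wlog st : s t / s <= t.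
  move=> H; have /orP[/H//|/H] := le_total s t.
  by rewrite distrC (distrC t).
rewrite /clamp01 (distrC s) (distrC (Num.max _ _)) (ger0_norm (_ : 0 <= t - s)).
  rewrite ger0_norm; last first.
    rewrite subr_ge0 /Num.max /Num.min; do ![case: ifP]; lra.
  by rewrite /Num.max /Num.min; do ![case: ifP]; lra.
by rewrite subr_ge0.
Qed.

(** A quasigeodesic extends to all of [R] by precomposition with the 1-Lipschitz
    retraction of [R] onto [0, 1]; conversely, a Lipschitz bound contains
    the continuity that quasigeodesics are asked to have. *)
Lemma quasiconvexP {R : realType} (Y : metricType R) (lambda : R) :
  0 <= lambda ->
  quasiconvex Y lambda <->
  forall x y : Y, exists f : R -> Y,
    [/\ lipschitz_path (lambda * mdist x y) f, f 0 = x & f 1 = y].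
Proof.
move=> l0; split=> qY x y; have [f [qf f0 f1]] := qY x y; last first.
  exists f; split=> //; split.
    exact/continuous_subspaceT/(lipschitz_path_continuous qf).
  by move=> s t _ _; rewrite f0 f1; exact: qf.
exists (f \o clamp01); have [_ lipf] := qf; split=> /=.
- move=> s t; rewrite -f0 -f1 /=.
  apply: le_trans (lipf _ _ (clamp01_itv s) (clamp01_itv t)) _.
  by rewrite ler_wpM2l ?clamp01_nonexpansive// mulr_ge0// mdist_ge0.
- by rewrite /clamp01 (min_idPr ler01) maxxx.
- by rewrite /clamp01 minxx (max_idPr ler01).
Qed.

Lemma hyperspace_inj {R : realType} {X : metricType R} {P : set (set X)}
  {PB : P `<=` BCl_sets X} : injective (@hyperspace_set R X P PB).
Proof.
move=> [A PA] [B PB'] /= AB; subst B.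
by congr Hyperspace; exact: Prop_irrelevance.
Qed.

Lemma closure_approx {R : realType} {X : metricType R} (S : set X) (x : X)
  (e : R) : closure S x -> 0 < e -> exists2 y, S y & mdist x y < e.
Proof.
move=> /(_ (ball x e) (nbhsx_ballx x e _)) + e0 => /(_ e0)[y [Sy]].
by rewrite ballEmdist /= => xy; exists y.
Qed.

Lemma metric_bounded_near {R : realType} {X : metricType R} (A S : set X)
  (M : R) : metric_bounded A ->
  (forall x, S x -> exists2 a, A a & mdist a x <= M) -> metric_bounded S.
Proof.
move=> [N AN] nS; exists (M + (N + M)) => x y /nS[a Aa ax] /nS[b Ab by_].
apply: le_trans (metric_triangle x a y) _.
rewrite lerD//; first by rewrite metric_sym.
apply: le_trans (metric_triangle a b y) _.
by rewrite lerD// AN.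
Qed.

Lemma BCl_closure {R : realType} {X : metricType R} (S : set X) :
  S !=set0 -> metric_bounded S -> BCl_sets X (closure S).
Proof.
move=> [x Sx] bS; split; last exact: closed_closure.
  by exists x; exact: subset_closure.
apply: (metric_bounded_near _ _ 1 bS) => y /(closure_approx _ _ 1)[]// z Sz yz.
by exists z => //; rewrite metric_sym ltW.
Qed.

(** A common Lipschitz constant passes from a family of curves to the closures
    of its time slices: a point of one slice is followed along its own curve to
    the other slice. *)
Lemma hausdorff_dist_slices {R : realType} {X : metricType R} {I : Type}
    (D : set I) (f : I -> R -> X) (C s t : R) :
  BCl_sets X (closure [set f i s | i in D]) ->
  BCl_sets X (closure [set f i t | i in D]) ->
  (forall i, D i -> lipschitz_path C (f i)) ->
  hausdorff_dist (closure [set f i s | i in D])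
                 (closure [set f i t | i in D]) <= C * `|s - t|.
Proof.
move=> Bs Bt lipf.
have follow u v e x : 0 < e -> closure [set f i u | i in D] x ->
    exists2 y, closure [set f i v | i in D] y &
      mdist x y < C * `|u - v| + e.
  move=> e0 /(closure_approx _ _ e)/(_ e0)[_ [i Di <-] xe].
  exists (f i v); first by apply: subset_closure; exists i.
  apply: le_lt_trans (metric_triangle x (f i u) _) _.
  by rewrite addrC ler_ltD// lipf.
apply/hausdorff_dist_leP => //; split=> e e0 x; first exact: follow.
by rewrite distrC; exact: follow.
Qed.

(** The hypothesis on closures says that the time slices stay in the
    hyperspace; it is phrased for arbitrary bounded images of subsets of
    A x B because that is enough both for the finite sets, where the finiteness
    of A x B is what matters, and for the closed ones, where boundedness is. *)
Lemma hyperspace_lipschitz_path {R : realType} {X : metricType R}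
    {P : set (set X)} {PB : P `<=` BCl_sets X} (A B : hyperspace PB)
    (sigma r : R) :
  0 <= sigma -> quasiconvex X sigma ->
  (forall a, hyperspace_set A a ->
    exists2 b, hyperspace_set B b & mdist a b <= r) ->
  (forall b, hyperspace_set B b ->
    exists2 a, hyperspace_set A a & mdist b a <= r) ->
  (forall (D : set (X * X)) (f : X * X -> X),
    D `<=` hyperspace_set A `*` hyperspace_set B -> D !=set0 ->
    metric_bounded (f @` D) -> P (closure (f @` D))) ->
  exists G : R -> hyperspace PB,
    [/\ lipschitz_path (sigma * r) G, G 0 = A & G 1 = B].
Proof.
move=> s0 /(quasiconvexP _ _ s0) qX AB BA PD.
have /choice[g gP] (p : X * X) : exists f : R -> X,
  [/\ lipschitz_path (sigma * mdist p.1 p.2) f, f 0 = p.1 & f 1 = p.2].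
  exact: qX.
pose D := [set p : X * X | [/\ hyperspace_set A p.1, hyperspace_set B p.2 &
    mdist p.1 p.2 <= r]].
have [[a0 Aa0] bA cA] := hyperspaceB A.
have [_ _ cB] := hyperspaceB B.
have lipg p : D p -> lipschitz_path (sigma * r) (g p).
  move=> [_ _ pr] s t; have [lipgp _ _] := gP p.
  by apply: le_trans (lipgp s t) _; rewrite ler_wpM2r// ler_wpM2l.
have PS t : P (closure [set g p t | p in D]).
  apply: PD => [p []//| |].
    by have [b Bb ab] := AB _ Aa0; exists (a0, b).
  apply: (metric_bounded_near _ _ (sigma * r * `|0 - t|) bA) => _ [p Dp <-].
  exists p.1; first by case: Dp.
  by have [_ {1}<- _] := gP p; exact: lipg.
exists (fun t => Hyperspace PB (PS t)); split.
- by move=> s t; apply: hausdorff_dist_slices => //; exact: (PB _ (PS _)).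
- apply: hyperspace_inj => /=; rewrite [RHS](closure_id _).1//; congr closure.
  apply/seteqP; split=> [_ [p [Ap _ _] <-]|a Aa].
    by have [_ -> _] := gP p.
  have [b Bb ab] := AB _ Aa; exists (a, b) => //.
  by have [_ -> _] := gP (a, b).
- apply: hyperspace_inj => /=; rewrite [RHS](closure_id _).1//; congr closure.
  apply/seteqP; split=> [_ [p [_ Bp _] <-]|b Bb].
    by have [_ _ ->] := gP p.
  have [a Aa ab] := BA _ Bb; exists (a, b).
    by split=> //; rewrite metric_sym.
  by have [_ _ ->] := gP (a, b).
Qed.

Lemma compact_nearest {R : realType} {X : metricType R} (B : set X) (a : X)
    (r : R) :
  B !=set0 -> compact B ->
  (forall e, 0 < e -> exists2 b, B b & mdist a b < r + e) ->
  exists2 b, B b & mdist a b <= r.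
Proof.
move=> B0 cB near.
have cont : continuous (mdist a : X -> R).
  move=> x; apply/cvgrPdist_lt => e e0.
  apply/metricType_numDomainType.nbhs_mdistP; exists e => //= y xy.
  apply: le_lt_trans xy.
  have := metric_triangle a x y; have := metric_triangle a y x.
  by rewrite (metric_sym y x) => ? ?; rewrite ler_norml; apply/andP; split; lra.
have [b /set_mem Bb bmin] := compact_EVT_min B0 cB (continuous_subspaceT cont).
exists b => //; apply/ler_addgt0Pr => e /near[b' Bb' /ltW]; apply: le_trans.
by apply: bmin; exact/mem_set.
Qed.

(** Between compact sets the Hausdorff distance itself serves as r, and so the
    quasiconvexity constant of X is inherited without loss. *)
Lemma quasiconvex_compact_hyperspace {R : realType} {X : metricType R}
    {P : set (set X)} (PB : P `<=` BCl_sets X) (lambda : R) :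
  0 <= lambda -> quasiconvex X lambda -> P `<=` compact ->
  (forall (A B : set X) (D : set (X * X)) (f : X * X -> X),
    P A -> P B -> D `<=` A `*` B -> D !=set0 ->
    metric_bounded (f @` D) -> P (closure (f @` D))) ->
  quasiconvex (hyperspace PB : metricType R) lambda.
Proof.
move=> l0 qX Pc PD; apply/quasiconvexP => // A B.
have hA := hyperspaceB A; have hB := hyperspaceB B.
have [AB BA] := (hausdorff_dist_leP _ hA hB).1 (lexx (mdist A B)).
have PA := hyperspace_setP A; have PB' := hyperspace_setP B.
have [A0 _ _] := hA; have [B0 _ _] := hB.
apply: hyperspace_lipschitz_path => //.
- by move=> a Aa; apply: compact_nearest => //; [exact: Pc|move=> e /AB; apply].
- by move=> b Bb; apply: compact_nearest => //; [exact: Pc|move=> e /BA; apply].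
- by move=> D f; exact: PD.
Qed.

Lemma quasiconvex_BCl {R : realType} {X : metricType R} (sigma lambda : R) :
  0 <= sigma -> 1 < lambda -> quasiconvex X sigma ->
  quasiconvex (BCl X) (sigma * lambda).
Proof.
move=> s0 l1 qX; have l0 : 0 <= lambda by rewrite ltW// (lt_trans ltr01).
apply/quasiconvexP => [|A B]; first exact: mulr_ge0.
have hA := hyperspaceB A; have hB := hyperspaceB B.
have [AB BA] := (hausdorff_dist_leP _ hA hB).1 (lexx (mdist A B)).
have [<-|nAB] := eqVneq A B.
  by exists (fun=> A); split=> // t u; rewrite !mdistxx mulr0 mul0r.
(* A and B differ, so the margin (lambda - 1) h is positive; the infima that
   define h can then be approached to within it. *)
have e0 : 0 < (lambda - 1) * mdist A B by rewrite mulr_gt0 ?subr_gt0 ?mdist_gt0.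
have eE : mdist A B + (lambda - 1) * mdist A B = lambda * mdist A B by ring.
rewrite -mulrA; apply: hyperspace_lipschitz_path => // [a Aa|b Bb|D f _].
- by have [b Bb /ltW] := AB _ e0 _ Aa; rewrite eE; exists b.
- by have [a Aa /ltW] := BA _ e0 _ Bb; rewrite eE; exists a.
- by move=> D0; apply: BCl_closure; exact: image_nonempty.
Qed.

Lemma quasiconvex_FS {R : realType} {X : metricType R} (lambda : R) :
  0 <= lambda -> quasiconvex X lambda -> quasiconvex (FS X) lambda.
Proof.
move=> l0 qX; apply: quasiconvex_compact_hyperspace => //.
  by move=> A [_]; exact: finite_compact.
move=> A B D f [_ fA] [_ fB] DAB D0 _.
have fD : finite_set (f @` D).
  by apply/finite_image/(sub_finite_set DAB)/finite_setX.
rewrite -(closure_id _).1.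
  by split=> //; exact: image_nonempty.
exact/(compact_closed (@metric_hausdorff R X))/finite_compact.
Qed.

Lemma proper_BClE {R : realType} {X : metricType R} :
  proper_metric X -> BCl_sets X = K_sets X.
Proof.
move=> pX; apply/seteqP; split=> A; last exact: K_sub_BCl.
by move=> [A0 bA cA]; split=> //; exact: pX.
Qed.

Theorem corollary3p17 (R : realType) (X : metricType R) :
  [/\ forall sigma lambda : R, 1 <= sigma -> 1 < lambda ->
        quasiconvex X sigma -> quasiconvex (BCl X) (sigma * lambda),
      forall lambda : R, 1 <= lambda ->
        quasiconvex X lambda -> quasiconvex (FS X) lambda
    & forall lambda : R, 1 <= lambda ->
        proper_metric X -> quasiconvex X lambda ->
        [/\ BCl_sets X = K_sets X, quasiconvex (BCl X) lambda
          & quasiconvex (K X) lambda]].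
Proof.
have ge0 (l : R) : 1 <= l -> 0 <= l by exact: le_trans.
split=> [sigma lambda /ge0 s0|lambda /ge0 l0|lambda /ge0 l0 pX qX].
- exact: quasiconvex_BCl.
- exact: quasiconvex_FS.
have BK := proper_BClE pX.
have BClc : BCl_sets X `<=` compact by rewrite BK => A [].
have clB (D : set (X * X)) (f : X * X -> X) : D !=set0 ->
    metric_bounded (f @` D) -> BCl_sets X (closure (f @` D)).
  by move=> D0; apply: BCl_closure; exact: image_nonempty.
split=> //; apply: quasiconvex_compact_hyperspace => //.
- by move=> A B D f _ _ _; exact: clB.
- by rewrite -BK.
- by move=> A B D f _ _ _; rewrite -BK; exact: clB.
Qed.
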